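(* Fix a round $t$ and state $s_t$. Let $\pi_\theta=\prod_{i\in\mathcal{N}_t}\pi_\theta^i$ be a factorized categorical policy and let $\mathbf{x}(\theta)$ be its induced marginals, $x_{(i,a)}(\theta)=\pi_\theta^i(a\mid o_{i,t})$. For any agent $i\in\mathcal{N}_t$ and action $a\in\mathcal{A}_{i,t}$, $$\mathbb{E}_{A_t^{-i}\sim\pi^{-i}}\big[F_t((i,a)\mid A_t^{-i};s_t)\big]=\frac{\partial\tilde f_t}{\partial x_{(i,a)}}\big(\mathbf{x}(\theta)\big),$$ where $\pi^{-i}=\prod_{j\in\mathcal{N}_t\setminus\{i\}}\pi_\theta^j$ is the joint policy of all agents except $i$.
   Context: $\mathcal{N}_t$ is a finite set of agents; each agent $i$ has a finite nonempty action set $\mathcal{A}_{i,t}$ and a local observation $o_{i,t}$ (determined by $s_t$). $\Omega_t=\{(i,a):i\in\mathcal{N}_t,a\in\mathcal{A}_{i,t}\}$, $\Omega_{i,t}=\{(i,a):a\in\mathcal{A}_{i,t}\}$, $\mathcal{I}_t=\{A\subseteq\Omega_t:|A\cap\Omega_{i,t}|\le1\ \forall i\}$. Each $\pi_\theta^i(\cdot\mid o_{i,t})$ is a probability distribution on $\mathcal{A}_{i,t}$; under $\pi_\theta$ agents sample $a_{i,t}$ independently, and $A_t^{-i}=\{(j,a_{j,t}):j\in\mathcal{N}_t\setminus\{i\}\}$. $F_t(\cdot;s_t):2^{\Omega_t}\to\mathbb{R}_{\ge0}$ is normalized, monotone and submodular (standing assumption), and $F_t(e\mid A;s_t)=F_t(A\cup\{e\};s_t)-F_t(A;s_t)$.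 Partition Multilinear Extension (PME): $\tilde f_t(\mathbf{x};s_t)=\sum_{A\in\mathcal{I}_t}F_t(A;s_t)\prod_{i\in\mathcal{N}_t}p_i(A;\mathbf{x})$, where $p_i(A;\mathbf{x})=x_{(i,a)}$ if $A\cap\Omega_{i,t}=\{(i,a)\}$ and $p_i(A;\mathbf{x})=1-\sum_{a'\in\mathcal{A}_{i,t}}x_{(i,a')}$ if $A\cap\Omega_{i,t}=\emptyset$. Partial derivatives are those of this polynomial in $\mathbf{x}$. *)

(* Defs.v *)
From HB Require Import structures.
From mathcomp Require Import all_boot all_order all_algebra.
From mathcomp Require Import all_classical all_reals all_analysis.

Set Implicit Arguments.
Unset Strict Implicit.
Unset Printing Implicit Defensive.

Import Order.TTheory GRing.Theory Num.Theory.
Import numFieldNormedType.Exports.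

Local Open Scope ring_scope.

Record fdist (R : numDomainType) (T : finType) := FDist {
  fdist_fun :> T -> R;
  fdist_ge0 : forall x, 0 <= fdist_fun x;
  fdist_sum1 : \sum_x fdist_fun x = 1
}.

Definition expectation_fdist (R : numDomainType) (T : finType) (mu : fdist R T)
    (g : T -> R) : R :=
  \sum_x mu x * g x.

Lemma prod_fdist_ge0 (R : numDomainType) (J : finType) (B : J -> finType)
    (p : forall j, fdist R (B j)) (b : {dffun forall j, B j}) :
  0 <= \prod_j p j (b j).
Proof. by apply: prodr_ge0 => j _; exact: fdist_ge0. Qed.

Lemma prod_fdist_sum1 (R : numDomainType) (J : finType) (B : J -> finType)
    (p : forall j, fdist R (B j)) :
  \sum_(b : {dffun forall j, B j}) \prod_j p j (b j) = 1.
Proof.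
rewrite (reindex (@dffun_of_fprod _ B)) /=; last first.
  exact/onW_bij/dffun_of_fprod_bij.
transitivity (\sum_(t : fprod B) \prod_(j in J) [ffun c => p j c] (t j)).
  by apply: eq_bigr => t _; apply: eq_bigr => j _; rewrite !ffunE.
rewrite big_fprod.
rewrite -(bigA_distr_big_dep _ (fun j => untag 0 [ffun c => p j c])).
rewrite big1 // => j _; rewrite -(big_tag (fun j c => [ffun c => p j c] c)).
by under eq_bigr do rewrite ffunE; exact: fdist_sum1.
Qed.

(* The law of a family of independent coordinates, the j-th one of law p j. *)
Definition prod_fdist (R : numDomainType) (J : finType) (B : J -> finType)
    (p : forall j, fdist R (B j)) : fdist R {dffun forall j, B j} :=
  FDist (prod_fdist_ge0 p) (prod_fdist_sum1 p).

Section SetFunctions.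
Variables (R : numDomainType) (T : finType).
Implicit Types (F : {set T} -> R) (A B : {set T}) (e : T).

Definition marginal_gain F e A : R := F (e |: A) - F A.

Definition normalized_setfun F : Prop := F finset.set0 = 0.

Definition monotone_setfun F : Prop := forall A B, A \subset B -> F A <= F B.

Definition submodular_setfun F : Prop :=
  forall A B e, A \subset B -> e \notin B ->
    marginal_gain F e B <= marginal_gain F e A.

End SetFunctions.

Section PartitionMultilinearExtension.
Variables (N : finType) (Act : N -> finType).

(* The ground set of pairs (i, a) with a an action of agent i. *)
Definition ground : finType := {i : N & Act i}.

Definition pair_of (i : N) (a : Act i) : ground := Tagged Act a.

Definition block (i : N) : {set ground} := [set pair_of a | a : Act i].

Definition feasible : {set {set ground}} :=
  [set A : {set ground} | [forall i, #|A :&: block i| <= 1]%N].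

Variable R : realType.

(* For a feasible A the action a selected here is unique if it exists, and the
   remaining case is that A does not meet the block of i. *)
Definition block_factor (A : {set ground}) (x : ground -> R) (i : N) : R :=
  if [pick a : Act i | A :&: block i == [set pair_of a]] is Some a
  then x (pair_of a)
  else 1 - \sum_(a : Act i) x (pair_of a).

Definition pme (F : {set ground} -> R) (x : ground -> R) : R :=
  \sum_(A in feasible) F A * \prod_(i : N) block_factor A x i.

Definition others (i : N) : finType := {j : N | j != i}.

Definition others_actions (i : N) : finType :=
  {dffun forall j : others i, Act (val j)}.

Definition others_policy (pi : forall j, fdist R (Act j)) (i : N) :
    fdist R (others_actions i) :=
  prod_fdist (fun j : others i => pi (val j)).

Definition others_set (i : N) (a : others_actions i) : {set ground} :=
  [set pair_of (a j) | j : others i].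

Definition marginals (pi : forall j, fdist R (Act j)) : ground -> R :=
  fun e => pi (tag e) (tagged e).

End PartitionMultilinearExtension.

(* The restriction of f to the line through x parallel to the e-th axis,
   parametrized by the e-th coordinate. *)
Definition coordinate_slice (R : realType) (T : finType) (f : (T -> R) -> R)
    (e : T) (x : T -> R) : R -> R :=
  fun z => f [eta x with e |-> z].

Definition partial (R : realType) (T : finType) (f : (T -> R) -> R)
    (e : T) (x : T -> R) : R :=
  derive1 (coordinate_slice f e x) (x e).

(* Main.v *)
(* Each summand of the PME is affine in x_(i,a): its slope is the product of the
   factors of the other agents, with sign + if A meets the block of i exactly in
   (i,a), sign - if A misses that block, and 0 otherwise. At the marginals of a
   policy the factor of an agent j whose block is missed is
   1 - \sum_c pi^j(c) = 0, so the surviving sets are others_set b and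
   (i,a) |: others_set b for a joint action b of the other agents, both weighted
   by the probability of b. *)
Require Import Defs.
From HB Require Import structures.
From mathcomp Require Import all_boot all_order all_algebra.
From mathcomp Require Import all_classical all_reals all_analysis.
From mathcomp Require Import ring.
Import Order.TTheory GRing.Theory Num.Theory.
Import numFieldNormedType.Exports.
Local Open Scope ring_scope.

Section Blocks.
Context {N : finType} {Act : N -> finType}.
Implicit Types (i j : N) (A C : {set ground Act}).

Lemma pair_of_inj j : injective (@pair_of N Act j).
Proof. by move=> c d /eqP; rewrite eq_Tagged => /eqP. Qed.

Lemma mem_block (e : ground Act) j : (e \in block Act j) = (tag e == j).
Proof.
apply/imsetP/eqP => [[c _ ->]//|<-]; exists (tagged e) => //.
by case: e.
Qed.

Lemma setI_block_disjoint C i j :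
  C \subset block Act i -> j != i -> C :&: block Act j = finset.set0.
Proof.
move=> /fintype.subsetP Ci ji; apply/setP => e; rewrite !inE mem_block.
case: (boolP (e \in C)) => //= /Ci; rewrite mem_block => /eqP ->.
by rewrite eq_sym (negbTE ji).
Qed.

Lemma feasible_block A j : A \in feasible Act ->
  A :&: block Act j = finset.set0 \/
  exists c : Act j, A :&: block Act j = [set pair_of c].
Proof.
rewrite inE => /forallP /(_ j).
rewrite leq_eqVlt ltnS leqn0 cards_eq0 => /orP[/cards1P[e Ae]|/eqP]; last by left.
right; have : e \in A :&: block Act j by rewrite Ae inE.
rewrite inE => /andP[_]; rewrite mem_block => /eqP ej.
(* Eliminating the tag equality identifies the two agents, so that the action stored in [e] gets the
   type [Act j]. *)
by case: e ej Ae => k c /= kj; case: j / kj => ->; exists c.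
Qed.

Lemma others_set_own_block i (b : others_actions Act i) :
  others_set b :&: block Act i = finset.set0.
Proof.
apply/setP => e; rewrite !inE mem_block.
by apply/negP => /andP[/imsetP[j _ ->] /=]; rewrite (negbTE (valP j)).
Qed.

Lemma others_set_block i (b : others_actions Act i) (j : others i) :
  others_set b :&: block Act (val j) = [set @pair_of N Act (val j) (b j)].
Proof.
apply/setP => e; rewrite !inE mem_block; apply/andP/eqP => [[]|->].
  by move=> /imsetP[k _ ->] /= /eqP /val_inj ->.
by split => //; apply/imsetP; exists j.
Qed.

Lemma mem_pair_of A j (c d : Act j) :
  A :&: block Act j = [set pair_of c] -> (pair_of d \in A) = (d == c).
Proof.
move=> /setP /(_ (pair_of d)); rewrite !inE mem_block eqxx andbT => ->.
by rewrite (inj_eq (@pair_of_inj j)).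
Qed.

Variable R : realType.
Implicit Type x : ground Act -> R.

Lemma block_factor_set1 A x j (c : Act j) :
  A :&: block Act j = [set pair_of c] -> block_factor A x j = x (pair_of c).
Proof.
move=> Ac; rewrite /block_factor; case: pickP => [d|/(_ c)]; rewrite Ac.
  by move=> /eqP /set1_inj /pair_of_inj ->.
by rewrite eqxx.
Qed.

Lemma block_factor_set0 A x j :
  A :&: block Act j = finset.set0 ->
  block_factor A x j = 1 - \sum_c x (pair_of (c : Act j)).
Proof.
move=> A0; rewrite /block_factor; case: pickP => // d; rewrite A0.
by move=> /eqP /setP /(_ (pair_of d)); rewrite !inE eqxx.
Qed.

Lemma eq_block_factor A x y j :
  (forall c : Act j, x (pair_of c) = y (pair_of c)) ->
  block_factor A x j = block_factor A y j.
Proof.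
by move=> xy; rewrite /block_factor; case: pickP => // _; under eq_bigr do rewrite xy.
Qed.

Lemma block_factor_marginals0 A (pi : forall j, fdist R (Act j)) j :
  A :&: block Act j = finset.set0 -> block_factor A (marginals pi) j = 0.
Proof. by move=> /block_factor_set0 ->; rewrite -(fdist_sum1 (pi j)) subrr. Qed.

(** Prescribing the trace [C] on the block of [i] lets one statement serve both kinds of surviving
    sets: [C] is later the singleton of [(i,a)] and the empty set. Sets that miss another block
    vanish; the rest are in bijection with joint actions of the other agents. *)
Lemma sum_feasible_block (hAct : forall j, (0 < #|Act j|)%N)
    (G : {set ground Act} -> R) (pi : forall j, fdist R (Act j)) i C :
  C \subset block Act i -> (#|C| <= 1)%N ->
  \sum_(A in feasible Act | A :&: block Act i == C)
    G A * \prod_(j | j != i) block_factor A (marginals pi) j =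
  expectation_fdist (others_policy pi i) (fun b => G (C :|: others_set b)).
Proof.
move=> Ci C1.
pose hit A := [forall j, (j != i) ==> (A :&: block Act j != finset.set0)].
rewrite (bigID hit) /= addrC big1 ?add0r => [|A /andP[_]]; last first.
  rewrite negb_forall => /existsP[j]; rewrite negb_imply negbK => /andP[ji /eqP A0].
  by rewrite (bigD1 j) //= block_factor_marginals0 // mul0r mulr0.
pose toset (b : others_actions Act i) := C :|: others_set b.
(* The default action, available by [hAct], only makes [toact] total: it is never selected when [A]
   meets every block other than that of [i]. *)
pose toact A : others_actions Act i := [ffun j : others i =>
  odflt (enum_val (Ordinal (hAct (val j)))) [pick c | pair_of c \in A]].
have toset_own b : toset b :&: block Act i = C.
  by rewrite finset.setIUl others_set_own_block finset.setU0; apply/finset.setIidPl.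
have toset_block b (j : others i) : toset b :&: block Act (val j) = [set @pair_of N Act (val j) (b j)].
  by rewrite finset.setIUl others_set_block (setI_block_disjoint _ i) ?(valP j) // finset.set0U.
have toactE A (j : others i) (c : Act (val j)) :
    A :&: block Act (val j) = [set pair_of c] -> toact A j = c.
  move=> Ac; rewrite ffunE; case: pickP => [d|/(_ c)]; rewrite (mem_pair_of _ _ c) //.
    by move/eqP.
  by rewrite eqxx.
(* Every [b] satisfies the reindexed condition; feasibility of [toset b] on the block of [i] is
   where [#|C| <= 1] enters. *)
rewrite (reindex_onto toset toact) => [|A /andP[/andP[fA /eqP AC] /forallP hitA]].
  apply: eq_big => b => [|_].
    apply/andP; split; last by apply/eqP/ffunP => j; exact: toactE.
    rewrite toset_own eqxx andbT inE; apply/andP; split; apply/forallP => j.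
      case: (eqVneq j i) => [->|ji]; first by rewrite toset_own.
      by rewrite (toset_block b (exist _ j ji)) cards1.
    apply/implyP => ji; rewrite (toset_block b (exist _ j ji)).
    by rewrite -cards_eq0 cards1.
  rewrite mulrC; congr (_ * _).
  rewrite (big_sub [pred j | j != i]) /=; apply: eq_bigr => j _.
  by rewrite (block_factor_set1 _ _ _ (b j)).
(* The blocks cover the ground set, so [toset (toact A) = A] can be checked one trace at a time. *)
apply/setP => -[j c].
have mem_own (B : {set ground Act}) : (existT _ j c \in B) = (existT _ j c \in B :&: block Act j).
  by rewrite inE mem_block eqxx andbT.
rewrite mem_own [RHS]mem_own; congr (_ \in _).
case: (eqVneq j i) => [->|ji]; first by rewrite toset_own AC.
rewrite (toset_block _ (exist _ j ji)).
case: (feasible_block A j fA) => [A0|[d Ad]].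
  by move: (hitA j); rewrite ji A0 eqxx.
by rewrite Ad (toactE A (exist _ j ji) d).
Qed.

(** The slope in [z] is 1, -1 or 0 according to the trace of [A]; as a difference of indicators it
    later splits into the two restricted sums. *)
Lemma block_factor_slice A x i (a : Act i) (z : R) : A \in feasible Act ->
  block_factor A [eta x with pair_of a |-> z] i =
  block_factor A [eta x with pair_of a |-> 0] i +
  z * ((A :&: block Act i == [set pair_of a])%:R -
       (A :&: block Act i == finset.set0)%:R).
Proof.
move=> fA; case: (feasible_block A i fA) => [A0|[c Ac]].
  have s0 : (finset.set0 == [set pair_of a]) = false.
    by rewrite eq_sym -cards_eq0 cards1.
  rewrite !block_factor_set0 // A0 s0 eqxx sub0r mulrN1.
  rewrite (bigD1 a) //= [in RHS](bigD1 a) //= !eqxx add0r.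
  rewrite opprD addrCA addrC; congr (1 - _ - _).
  by apply: eq_bigr => c ca; rewrite (inj_eq (@pair_of_inj i)) (negbTE ca).
rewrite !(block_factor_set1 _ _ _ c) // Ac /= -cards_eq0 cards1 subr0.
rewrite (inj_eq set1_inj) (inj_eq (@pair_of_inj i)).
by case: eqP => _; rewrite ?add0r ?mulr1 // mulr0 addr0.
Qed.

(** Only the factor of agent [i] reads the coordinate [(i,a)], so each summand inherits the affine
    form of that factor. *)
Lemma pme_slice (G : {set ground Act} -> R) x i (a : Act i) (z : R) :
  let rest C := \sum_(A in feasible Act | A :&: block Act i == C)
    G A * \prod_(j | j != i) block_factor A x j in
  coordinate_slice (pme G) (pair_of a) x z =
  coordinate_slice (pme G) (pair_of a) x 0 +
  z * (rest [set pair_of a] - rest finset.set0).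
Proof.
(* The trace conditions move into the summands, so that all sums run over the feasible sets and can
   be compared termwise. *)
rewrite /coordinate_slice /pme !big_mkcondr /= -sumrB mulr_sumr -big_split /=.
apply: eq_bigr => A fA.
have rest_slice w : \prod_(j | j != i) block_factor A [eta x with pair_of a |-> w] j =
    \prod_(j | j != i) block_factor A x j.
  apply: eq_bigr => j ji; apply: eq_block_factor => c /=.
  by case: eqP => // /(congr1 tag) /= ij; rewrite ij eqxx in ji.
rewrite !(bigD1 (P := xpredT) i) //= !rest_slice block_factor_slice //.
(* The identity is polynomial for all four outcomes of the two trace tests, even the impossible one
   where both succeed. *)
by do 2 case: eqP => _ /=; ring.
Qed.

End Blocks.

Theorem propositionE2 (R : realType)
    (N : finType) (Act : N -> finType) (hAct : forall i, (0 < #|Act i|)%N)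
    (State : Type) (s : State)
    (Obs : N -> Type) (obs : forall i, State -> Obs i)
    (F : {set ground Act} -> State -> R)
    (F_ge0 : forall A, 0 <= F A s)
    (F_norm : normalized_setfun (F ^~ s))
    (F_mono : monotone_setfun (F ^~ s))
    (F_subm : submodular_setfun (F ^~ s))
    (Theta : Type) (pi : Theta -> forall i, Obs i -> fdist R (Act i))
    (theta : Theta) (i : N) (a : Act i) :
  let pi_s := fun j : N => pi theta j (obs j s) in
  let x := marginals pi_s in
  derivable (coordinate_slice (pme (F ^~ s)) (pair_of a) x)
    (x (pair_of a)) 1 /\
  expectation_fdist (others_policy pi_s i)
    (fun b => marginal_gain (F ^~ s) (pair_of a) (others_set b)) =
  partial (pme (F ^~ s)) (pair_of a) x.
Proof.
move=> pi_s x.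
set f := coordinate_slice _ _ _; set m := (X in _ /\ X = _).
(* The slope is already the expected marginal gain, so differentiation reduces to that of an affine
   map. *)
have f_affine : f = cst (f 0) + m \*: id.
  apply/funext => z; rewrite [LHS]pme_slice; congr (_ + _).
  rewrite mulrC; congr (_ * _).
  rewrite !sum_feasible_block ?finset.sub0set ?cards0 ?cards1 //; last first.
    by rewrite finset.sub1set mem_block.
  (* Both expectations carry the same weight at [b], so their difference is the expectation of the
     marginal gain. *)
  rewrite -sumrB; apply: eq_bigr => b _.
  by rewrite -mulrBr finset.set0U.
have f_derive : is_derive (x (pair_of a)) 1 f m.
  rewrite f_affine; apply: is_derive_eq.
  by rewrite add0r; exact: mulr1.
split; first exact: ex_derive.
by rewrite /partial derive1E; symmetry; exact: derive_val.
Qed.
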